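(* For each positive integer $n$, place $n^2$ line-bishops at random on the $3$-dimensional chessboard with side length $n$. Then, as $n\to\infty$, the expected proportion of safe spaces converges to $$\frac{-1+9e^2-2e^3}{3e^6}.$$
   Context: The $3$-dimensional board of side length $n$ is the set of spaces $\{1,\dots,n\}^3$. ''Placing $n^2$ pieces at random'' means that the set of occupied spaces (the board configuration) is chosen uniformly among all $\binom{n^3}{n^2}$ subsets of $n^2$ distinct spaces. A line-bishop attacks as a $2$-dimensional bishop inside each axis-parallel $2$-dimensional plane containing it, and attacks no other spaces: a line-bishop at $(a_1,a_2,a_3)$ attacks $(x_1,x_2,x_3)$ if there are two distinct indices $i,j$ with $|x_i-a_i|=|x_j-a_j|$ while the remaining coordinate of the two spaces is equal. A space is safe under a board configuration if it is neither occupied nor attacked by any of the placed pieces. The expected proportion of safe spaces is the expected number of safe spaces divided by $n^3$. *)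

(* Defs.v *)
From mathcomp Require Import all_boot all_order all_algebra.
From mathcomp Require Import all_classical all_reals all_analysis.

Set Implicit Arguments.
Unset Strict Implicit.
Unset Printing Implicit Defensive.

Import Order.TTheory GRing.Theory Num.Theory.
Import numFieldNormedType.Exports.

Local Open Scope ring_scope.

(* Coordinates run over {0, ..., n - 1} instead of {1, ..., n}; only equalities
   and differences of coordinates are ever used. *)
Definition space (n : nat) : finType := {ffun 'I_3 -> 'I_n}.

(* The distance is the absolute value of the integer difference, not a
   truncated one.  A bishop attacks its own space under this definition, which
   is harmless: a safe space has to be unoccupied anyway. *)
Definition attacks (n : nat) (a x : space n) : bool :=
  [exists i : 'I_3, exists j : 'I_3,
    [&& i != j, `|x i - a i|%N == `|x j - a j|%N
      & [forall k : 'I_3, (k != i) && (k != j) ==> (x k == a k)]]].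

Definition safe (n : nat) (B : {set space n}) (x : space n) : bool :=
  (x \notin B) && [forall a in B, ~~ attacks a x].

Definition safe_spaces (n : nat) (B : {set space n}) : {set space n} :=
  [set x | safe B x]%SET.

Definition configurations (n m : nat) : {set {set space n}} :=
  [set B : {set space n} | #|B| == m]%SET.

Definition uniform_expectation (R : realType) (T : finType) (A : {set T})
    (f : T -> R) : R :=
  (\sum_(B in A) f B) / #|A|%:R.

(* At n = 0 this is a division by zero, whose value is irrelevant to the
   limit. *)
Definition expected_safe_proportion (R : realType) (n : nat) : R :=
  uniform_expectation (configurations n (n ^ 2)%N)
    (fun B => #|safe_spaces B|%:R)
  / (n ^ 3)%N%:R.

(* Main.v *)
Require Import Defs.
From mathcomp Require Import all_boot all_order all_algebra.
From mathcomp Require Import all_classical all_reals all_analysis.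
From mathcomp Require Import zify ring lra.

Set Implicit Arguments.
Unset Strict Implicit.
Unset Printing Implicit Defensive.

Import Order.TTheory GRing.Theory Num.Theory.
Import numFieldNormedType.Exports.

Local Open Scope ring_scope.

(** A space x is safe exactly when the configuration avoids the set A(x) of the
spaces attacking x (x included), so it is safe with probability
C(n^3 - |A(x)|, n^2) / C(n^3, n^2).  As |A(x)| = O(n), this quotient is
exp(- |A(x)| / n) up to a factor tending to 1 uniformly in x.

With e_i the distance of x_i to the nearer end of {0, ..., n - 1}, one finds
|A(x)| = 3 n - 2 + 2 (min(e_0, e_1) + min(e_0, e_2) + min(e_1, e_2)).  Ranking
the coordinates by increasing distance to the ends turns 2 e_i into the rank
r_i up to 1, so with z = exp(- 1 / n) the expected proportion is
e^-3 n^-3 T_n up to a factor tending to 1, where T_n is the sum over all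
triples of ranks of z^(min(r_0, r_1) + min(r_0, r_2) + min(r_1, r_2)).
Splitting off the triples with a zero rank gives a recurrence for T_n, hence a
closed form, whose limit follows from n (1 - z) --> 1 and z^n = 1 / e. *)

(** * Spaces attacking a given space *)

Lemma sum_interval n lo hi : (\sum_(q < n) (lo <= q < hi) = minn hi n - lo)%N.
Proof. by elim: n => [|n IH]; rewrite ?big_ord0 ?big_ord_recr /= ?IH; lia. Qed.

Lemma sum_eqn n a c : (\sum_(q < n) (q + a == c) = (a <= c < n + a))%N.
Proof.
elim: n => [|n IH]; first by rewrite big_ord0; lia.
rewrite big_ord_recr /= IH; case: (ltngtP (n + a)%N c); lia.
Qed.

Definition edge n (x : nat) : nat := minn x (n.-1 - x).

Lemma distn_eqE (x p y q : nat) :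
  (`|x - p|%N == `|y - q|%N) = (q + x == p + y)%N || (q + p == x + y)%N.
Proof. lia. Qed.

(** The conditions [sum_eqn] yields for the two diagonals, restated as intervals of rows so that
    [sum_interval] applies. *)
Lemma diagonal_intervals n x y p : (p < n -> x < n -> y < n ->
  (x <= p + y < n + x) = (x - y <= p < n + x - y) /\
  (p <= x + y < n + p) = ((x + y).+1 - n <= p < (x + y).+1))%N.
Proof. by move=> *; split; lia. Qed.

(* Row p meets each of the two diagonals through (x, y) in at most one cell,
   and meets both in the same cell only for p = x; the summand p + 0 == x has
   the shape of [sum_eqn]. *)
Lemma sum_diagonals n (x y : 'I_n) :
  (\sum_(p < n) \sum_(q < n) (`|x - p|%N == `|y - q|%N :> nat)
   = n + (minn (edge n x) (edge n y)).*2)%N.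
Proof.
have [ltxn ltyn] := (ltn_ord x, ltn_ord y).
have row (p : 'I_n) : (\sum_(q < n) (`|x - p|%N == `|y - q|%N :> nat)
    + (p + 0 == x) = (x - y <= p < n + x - y)
     + ((x + y).+1 - n <= p < (x + y).+1))%N.
  have cell (q : 'I_n) : ((`|x - p|%N == `|y - q|%N :> nat)
      + (p == x :> nat) * (q + 0 == y) = (q + x == p + y) + (q + p == x + y))%N.
    rewrite distn_eqE addn0.
    by case: (eqVneq (q + x)%N); case: (eqVneq (q + p)%N);
      case: (eqVneq (p : nat) x); case: (eqVneq (q : nat) y) => /=; lia.
  move/(congr1 (fun f : 'I_n -> nat => \sum_(q < n) f q)%N): (funext cell).
  rewrite !big_split /= -big_distrr /= !sum_eqn addn0 ltyn muln1 !addn0.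
  by case: (@diagonal_intervals n x y p) => // -> ->.
move/(congr1 (fun f : 'I_n -> nat => \sum_(q < n) f q)%N): (funext row).
rewrite !big_split /= !sum_interval sum_eqn addn0 ltxn /edge.
set S := (\sum_(i < n) _)%N => E.
(* The intervals have lengths n - |x - y| and n - |x + y + 1 - n|; the cases resolve the absolute
   values. *)
case: (leqP x y) E => h; case: (leqP (x + y).+1 n) => h2; lia.
Qed.

Notation i0 := (ord0 : 'I_3).
Notation i1 := (lift ord0 ord0 : 'I_3).
Notation i2 := (lift ord0 (lift ord0 ord0) : 'I_3).

Lemma big_space (V : Type) (idx : V) (op : Monoid.com_law idx) n
    (F : 'I_n -> 'I_n -> 'I_n -> V) :
  \big[op/idx]_(a : Defs.space n) F (a i0) (a i1) (a i2) =
  \big[op/idx]_(p < n) \big[op/idx]_(q < n) \big[op/idx]_(r < n) F p q r.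
Proof.
under [RHS]eq_bigr do rewrite pair_big_dep /=.
rewrite pair_big_dep /=.
pose h (t : 'I_n * ('I_n * 'I_n)) : Defs.space n :=
  [ffun k : 'I_3 => if val k is k'.+1 then (if k' is 0 then t.2.1 else t.2.2)
                    else t.1].
rewrite (reindex h) /=; last first.
  exists (fun a => (a i0, (a i1, a i2))) => [[p [q r]]|a] _; rewrite ?ffunE //=.
  apply/ffunP => k; rewrite ffunE.
  by case: k => [[|[|[|//]]] lt] /=; congr (a _); apply: val_inj.
by apply: eq_bigr => -[p [q r]] _; rewrite !ffunE.
Qed.

Lemma exists_I3 (P : pred 'I_3) : [exists i, P i] = [|| P i0, P i1 | P i2].
Proof.
apply/existsP/or3P => [[i Pi]|]; last by case; [exists i0|exists i1|exists i2].
by case: i Pi => [[|[|[|//]]] lt] Pi; [apply: Or31|apply: Or32|apply: Or33];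
  apply: etrans Pi; congr P; apply: val_inj.
Qed.

Lemma forall_I3 (P : pred 'I_3) : [forall i, P i] = [&& P i0, P i1 & P i2].
Proof.
apply/forallP/and3P => [?//|[P0 P1 P2] i].
by case: i => [[|[|[|//]]] lt]; [move: P0|move: P1|move: P2];
  apply: etrans; congr P; apply: val_inj.
Qed.

(** One disjunct for each axis-parallel plane through [x]: swapping the two indices only swaps the
    sides of the equation. *)
Lemma attacksE n (a x : Defs.space n) :
  attacks a x =
  [|| (`|x i0 - a i0|%N == `|x i1 - a i1|%N) && (x i2 == a i2),
      (`|x i0 - a i0|%N == `|x i2 - a i2|%N) && (x i1 == a i1) |
      (`|x i1 - a i1|%N == `|x i2 - a i2|%N) && (x i0 == a i0)].
Proof.
rewrite /attacks !exists_I3 !forall_I3 /=.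
rewrite ![`|x i1 - a i1|%N == `|x i0 - a i0|%N]eq_sym.
rewrite ![`|x i2 - a i2|%N == `|x i0 - a i0|%N]eq_sym.
rewrite ![`|x i2 - a i2|%N == `|x i1 - a i1|%N]eq_sym.
rewrite !orbF !andbT.
by do 3!case: (_ == _ :> nat); do 3!case: (_ == _ :> 'I_n).
Qed.

Lemma sum_pred1 (T : finType) (t : T) : (\sum_(u : T) (u == t) = 1)%N.
Proof. by rewrite (bigD1 t) //= eqxx big1 // => u /negbTE ->. Qed.

Lemma card_attackers n (x : Defs.space n) :
  (#|[set a | attacks a x]| + 2 =
   3 * n + (minn (edge n (x i0)) (edge n (x i1))
     + minn (edge n (x i0)) (edge n (x i2))
     + minn (edge n (x i1)) (edge n (x i2))).*2)%N.
Proof.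
pose D (u v w : 'I_n) (p q r : 'I_n) : nat :=
  ((`|u - p|%N == `|v - q|%N) * (r == w))%N.
have sumD u v w : (\sum_(p < n) \sum_(q < n) \sum_(r < n) D u v w p q r
    = n + (minn (edge n u) (edge n v)).*2)%N.
  rewrite -sum_diagonals; apply: eq_bigr => p _; apply: eq_bigr => q _.
  by rewrite /D -big_distrr /= sum_pred1 muln1.
(* The diagonals in the three planes through [x] only share [x], which is
   therefore counted three times. *)
have -> : (#|[set a | attacks a x]| + 2 = \sum_(a : Defs.space n)
    (D (x i0) (x i1) (x i2) (a i0) (a i1) (a i2)
     + D (x i0) (x i2) (x i1) (a i0) (a i2) (a i1)
     + D (x i1) (x i2) (x i0) (a i1) (a i2) (a i0)))%N.
  rewrite [LHS](_ : _ = #|[set a | attacks a x]|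
      + \sum_(a : Defs.space n) (a == x) * 2)%N; last first.
    by rewrite -big_distrl /= sum_pred1.
  rewrite -sum1_card big_mkcond -big_split; apply: eq_bigr => a _ /=.
  rewrite inE attacksE.
  have -> : (a == x) = [&& a i0 == x i0, a i1 == x i1 & a i2 == x i2].
    apply/eqP/and3P => [-> //|[/eqP e0 /eqP e1 /eqP e2]].
    apply/ffunP => -[[|[|[|//]]] lt];
      [move: e0|move: e1|move: e2]; congr (a _ = x _); exact: val_inj.
  rewrite /D ![x _ == a _]eq_sym.
  have dist0 k : (`|x k - a k|%N == 0) = (a k == x k).
    apply/eqP/eqP => [d0|->]; last by rewrite distnn.
    by apply: ord_inj; lia.
  (* Two of the planar conditions hold together only if all three distances vanish. *)
  rewrite -!dist0; move: `|_|%N `|_|%N `|_|%N => [|u] [|v] [|w];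
    by rewrite ?andbF ?andbT ?muln0 ?muln1 ?orbF ?eqxx //; case: eqP.
apply: etrans.
  apply: (big_space addn (fun p q r => D (x i0) (x i1) (x i2) p q r
  + D (x i0) (x i2) (x i1) p r q + D (x i1) (x i2) (x i0) q r p)%N).
rewrite /=.
under eq_bigr do under eq_bigr do rewrite !big_split /=.
under eq_bigr do rewrite !big_split /=.
rewrite !big_split /= sumD.
under [in X in (_ + X + _)%N]eq_bigr do rewrite exchange_big /=.
rewrite sumD.
rewrite [X in (_ + X)%N]exchange_big /=.
under [in X in (_ + X)%N]eq_bigr do rewrite exchange_big /=.
rewrite sumD; lia.
Qed.

(** * Counting configurations that leave a space safe *)

Lemma card_configurations n m : #|configurations n m| = 'C(n ^ 3, m).
Proof.
have <- : #|[set: Defs.space n]| = (n ^ 3)%N.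
  by rewrite cardsT card_ffun !card_ord.
by rewrite -cards_draws; apply: eq_card => B; rewrite !inE finset.subsetT.
Qed.

(** Double counting: [x] is safe under [B] exactly when [B] lies in the complement of the attackers
    of [x]. As [x] attacks itself, this also makes it unoccupied. *)
Lemma sum_safe_spaces n m :
  (\sum_(B in configurations n m) #|safe_spaces B| =
   \sum_(x : Defs.space n) 'C(n ^ 3 - #|[set a | attacks a x]|, m))%N.
Proof.
have attacks_self (x : Defs.space n) : attacks x x.
  by rewrite attacksE !distnn !eqxx.
under eq_bigr do rewrite -sum1_card big_mkcond /=.
rewrite exchange_big /=; apply: eq_bigr => x _.
rewrite -big_mkcondr sum1_card.
have -> : (n ^ 3 - #|[set a | attacks a x]| = #|~: [set a | attacks a x]|)%N.
  by rewrite [RHS]cardsCs finset.setCK card_ffun !card_ord.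
rewrite -cards_draws; apply: eq_card => B; rewrite inE [LHS]andbC !inE.
congr (_ && _); rewrite /safe.
apply/andP/fintype.subsetP => [[_ /forallP safeB] a aB|sub].
  by rewrite !inE; move/implyP: (safeB a); apply.
split; first by apply/negP => /sub; rewrite !inE attacks_self.
by apply/forallP => a; apply/implyP => /sub; rewrite !inE.
Qed.

(** * Ranking coordinates by distance to the ends *)

(* The ranks 0, 1, 2, 3, ... are sent to 0, n - 1, 1, n - 2, ... *)
Lemma fold_rank_subproof n (r : 'I_n) :
  ((if odd r then n.-1 - r./2 else r./2) < n)%N.
Proof. by have := ltn_ord r; case: ifP; lia. Qed.

Definition fold_rank n (r : 'I_n) : 'I_n := Ordinal (fold_rank_subproof r).

Lemma fold_rank_inj n : injective (@fold_rank n).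
Proof.
move=> r s /(congr1 val) /=; have := ltn_ord r; have := ltn_ord s.
move=> lts ltr eqrs; apply: ord_inj.
have := odd_double_half r; have := odd_double_half s.
by case: (odd r) eqrs; case: (odd s) => /=; lia.
Qed.

Lemma edge_fold_rank n (r : 'I_n) : edge n (fold_rank r) = r./2.
Proof.
have := ltn_ord r; have := odd_double_half r; rewrite /edge /=.
by case: (odd r) => /=; lia.
Qed.

Lemma big_edge (V : Type) (idx : V) (op : Monoid.com_law idx) n (F : nat -> V) :
  \big[op/idx]_(x < n) F (edge n x) = \big[op/idx]_(r < n) F r./2.
Proof.
rewrite (reindex_inj (@fold_rank_inj n)) /=.
by apply: eq_bigr => r _; rewrite edge_fold_rank.
Qed.

(** * Probability of being safe *)

(** The new factor is the probability that one more given space stays empty when [A] given spaces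
    are already empty. *)
Lemma bin_ratioS (R : realType) N m A : (m + A.+1 <= N)%N ->
  'C(N - A.+1, m)%:R = 'C(N - A, m)%:R * (1 - m%:R / (N - A)%:R) :> R.
Proof.
move=> leN; have NA0 : (N - A)%:R != 0 :> R by rewrite pnatr_eq0; lia.
apply: (mulfI NA0); rewrite -natrM subnS mul_bin_down natrM natrB; last by lia.
by field.
Qed.

(** Each factor 1 - m / (N - i) is at most 1 - m / N, hence at most exp(- m / N). *)
Lemma bin_ratio_le (R : realType) N m A : (0 < N)%N -> (m + A <= N)%N ->
  'C(N - A, m)%:R / 'C(N, m)%:R <= expR (- (m%:R / N%:R)) ^+ A :> R.
Proof.
move=> N0; elim: A => [|A IH] leN.
  by rewrite subn0 expr0 divff // pnatr_eq0 -lt0n bin_gt0; lia.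
rewrite bin_ratioS // mulrAC exprSr ler_pM ?mulr_ge0 ?invr_ge0 ?IH //; try lia.
  by rewrite subr_ge0 ler_pdivrMr ?mul1r ?ler_nat ?ltr0n; lia.
apply: le_trans (expR_ge1Dx _); rewrite lerD2l lerN2.
by rewrite ler_wpM2l // lef_pV2 ?posrE ?ltr0n ?ler_nat; lia.
Qed.

Lemma bin_ratio_ge (R : realType) N m A (b : R) : 0 <= b -> (m + A <= N)%N ->
  (forall i, (i < A)%N -> b <= 1 - m%:R / (N - i)%:R) ->
  b ^+ A <= 'C(N - A, m)%:R / 'C(N, m)%:R.
Proof.
move=> b0; elim: A => [|A IH] leN hb.
  by rewrite subn0 expr0 divff // pnatr_eq0 -lt0n bin_gt0; lia.
rewrite bin_ratioS // mulrAC exprSr ler_pM ?exprn_ge0 ?hb ?IH //; first lia.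
by move=> i iA; apply: hb; lia.
Qed.

(* For i <= 6 n, the probability that the i-th further attacking space stays
   unoccupied is at least 1 - n^2 / (n^3 - 6 n) = 1 / (1 + c), hence at least
   exp(- c), with c this rate. *)
Definition lower_rate (R : realType) (n : nat) : R :=
  n%:R / (n%:R ^+ 2 - n%:R - 6).

(** To be used with [A] the number of attackers and [s] the [min_sum] of the ranks; the slack 5
    covers the rounding of ranks and the constant term of [A]. *)
Lemma safe_probability_bounds (R : realType) n A s (z := expR (- n%:R^-1) : R) :
  (4 <= n)%N -> (3 * n + s <= A + 5)%N -> (A <= 3 * n + s)%N ->
  (s <= 3 * n)%N ->
  expR (6 - 6 * n%:R * lower_rate R n) * expR (- 3) * z ^+ s
  <= 'C(n ^ 3 - A, n ^ 2)%:R / 'C(n ^ 3, n ^ 2)%:R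
  <= z ^- 5 * expR (- 3) * z ^+ s.
Proof.
move=> n4 leA geA les.
have nR : 4 <= n%:R :> R by rewrite (ler_nat R 4).
(* The polynomial is (n - 3)(n + 2). *)
have D0 : 0 < n%:R ^+ 2 - n%:R - 6 :> R by nra.
have A6 : (A <= 6 * n)%N by lia.
have leN : (n ^ 2 + A <= n ^ 3)%N by rewrite !expnS expn0; nia.
have z_gt0 : 0 < z by exact: expR_gt0.
have zE k : z ^+ k = expR (- (k%:R / n%:R)).
  by rewrite /z -expRM_natl mulrN.
apply/andP; split; last first.
  apply: le_trans (bin_ratio_le _ _ leN) _; first by rewrite expn_gt0; lia.
  have -> : (n ^ 2)%:R / (n ^ 3)%:R = n%:R^-1 :> R.
    by rewrite !natrX; field; lra.
  rewrite -/z -mulrA ler_pdivlMl ?exprn_gt0 // -exprD.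
  (* Both sides become powers of z <= 1, so only the exponents 3 n + s <= 5 + A have to be
     compared. *)
  have -> : expR (- 3) = z ^+ (3 * n).
    by rewrite zE natrM; congr expR; field; lra.
  rewrite -exprD; apply: ler_wiXn2l; first exact: ltW.
    by rewrite /z -expR0 ler_expR oppr_le0 invr_ge0.
  by lia.
pose c := lower_rate R n.
have c0 : 0 <= c by rewrite divr_ge0 ?ltW //; lra.
(* Since A <= 3 n + s <= 6 n and c >= 1 / n, the product A c is at most 3 + s / n + 6 n (c - 1 /
   n). *)
apply: (@le_trans _ _ (expR (- c) ^+ A)).
  rewrite zE -expRM_natl -!expRD ler_expR mulrN.
  have -> : 6 - 6 * n%:R * lower_rate R n + - 3 - s%:R / n%:R =
    - (3 * n%:R + s%:R) / n%:R - 6 * n%:R * (c - n%:R^-1).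
    by rewrite -/c; field; lra.
  have cn : n%:R^-1 <= c.
    rewrite /c /lower_rate ler_pdivlMr // ler_pdivrMl; first nra.
    lra.
  have hA : A%:R <= 3 * n%:R + s%:R :> R.
    by rewrite -(natrM R 3) -natrD ler_nat.
  have hs : 3 * n%:R + s%:R <= 6 * n%:R :> R.
    by rewrite -!(natrM R) -natrD ler_nat; lia.
  have hs0 : 0 <= 3 * n%:R + s%:R :> R by rewrite -(natrM R 3) -natrD.
  by nra.
apply: bin_ratio_ge => [||i iA] //.
rewrite expRN.
have c1 : 0 < 1 + c by lra.
apply: (@le_trans _ _ (1 + c)^-1).
  by rewrite lef_pV2 ?posrE ?expR_gt0 ?expR_ge1Dx.
have hN : n%:R ^+ 3 - 6 * n%:R <= (n ^ 3 - i)%:R :> R.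
  rewrite natrB; last by lia.
  by rewrite natrX lerD2l lerN2 -(natrM R 6) ler_nat; lia.
have hN0 : 0 < n%:R ^+ 3 - 6 * n%:R :> R by rewrite exprS; nra.
apply: (@le_trans _ _ (1 - n%:R ^+ 2 / (n%:R ^+ 3 - 6 * n%:R))).
  rewrite /c /lower_rate le_eqVlt; apply/orP; left; apply/eqP; field.
  by do !(apply/andP; split); apply: lt0r_neq0; nra.
rewrite lerD2l lerN2 natrX ler_wpM2l ?exprn_ge0 //.
by rewrite lef_pV2 ?posrE //; apply: lt_le_trans hN.
Qed.

Lemma expected_safe_proportionE (R : realType) n :
  expected_safe_proportion R n =
  (\sum_(x : Defs.space n) 'C(n ^ 3 - #|[set a | attacks a x]|, n ^ 2)%:R
     / 'C(n ^ 3, n ^ 2)%:R) / (n ^ 3)%N%:R.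
Proof.
rewrite /expected_safe_proportion /uniform_expectation card_configurations.
by rewrite -natr_sum sum_safe_spaces natr_sum -[in RHS]mulr_suml.
Qed.

(** * Rank sums *)

Definition min_sum (i j k : nat) : nat := (minn i j + minn i k + minn j k)%N.
Definition pair_sum (R : realType) (z : R) (n : nat) : R :=
  \sum_(i < n) \sum_(j < n) z ^+ minn i j.
Definition triple_sum (R : realType) (z : R) (n : nat) : R :=
  \sum_(i < n) \sum_(j < n) \sum_(k < n) z ^+ min_sum i j k.

Lemma pair_sumS (R : realType) (z : R) n :
  pair_sum z n.+1 = z * pair_sum z n + n.*2.+1%:R.
Proof.
rewrite /pair_sum big_ord_recl (eq_bigr (fun=> 1)); last first.
  by move=> j _; rewrite min0n expr0.
rewrite sumr_const card_ord.
rewrite (eq_bigr (fun i : 'I_n => 1 + z * \sum_(j < n) z ^+ minn i j)).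
  rewrite big_split /= sumr_const card_ord -mulr_sumr.
  by rewrite -addnn -[(n + n).+1]addSn natrD; ring.
move=> i _; rewrite big_ord_recl minn0 expr0 mulr_sumr; congr (_ + _).
by apply: eq_bigr => j _; rewrite /= /bump /= !add1n minnSS exprS.
Qed.

(** If one rank is zero, only the minimum of the other two remains; lowering three positive ranks by
    1 lowers [min_sum] by 3. *)
Lemma triple_sumS (R : realType) (z : R) n :
  triple_sum z n.+1 =
  z ^+ 3 * triple_sum z n + 3 * z * pair_sum z n + (3 * n).+1%:R.
Proof.
rewrite /triple_sum /min_sum.
pose P (i : nat) := \sum_(j < n) z ^+ minn i j.
have face : \sum_(i < n.+1) \sum_(j < n.+1)
    z ^+ (minn 0 i + minn 0 j + minn i j) = pair_sum z n.+1.
  by apply: eq_bigr => i _; apply: eq_bigr => j _; rewrite !min0n.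
rewrite big_ord_recl /= face.
rewrite (eq_bigr (fun i : 'I_n => 1 + z * P i + z * P i +
    z ^+ 3 * \sum_(j < n) \sum_(k < n)
      z ^+ (minn i j + minn i k + minn j k))); last first.
  move=> i _; rewrite big_ord_recl [X in X + _]big_ord_recl /=.
  rewrite !minn0 !addn0 !expr0 -!addrA; congr (_ + _).
  rewrite [in z * P i]/P !mulr_sumr; congr (_ + _).
    apply: eq_bigr => j _; rewrite /bump /= !add1n minnSS min0n.
    by rewrite add0n addn0 exprS.
  rewrite -big_split; apply: eq_bigr => j _ /=.
  rewrite big_ord_recl /= /bump /= !add1n !minnSS minn0 !addn0 exprS.
  congr (_ + _); rewrite mulr_sumr; apply: eq_bigr => k _.
  by rewrite /= /bump /= !add1n !minnSS -exprD; congr (_ ^+ _); lia.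
rewrite !big_split /= sumr_const card_ord -!mulr_sumr.
rewrite pair_sumS -/(pair_sum z n).
have -> : (3 * n).+1%:R = n.*2.+1%:R + n%:R :> R.
  by rewrite -natrD; congr _%:R; lia.
by rewrite /P -/(pair_sum z n); ring.
Qed.

Lemma pair_sumE (R : realType) (z : R) n : z != 1 ->
  pair_sum z n = 2 * n%:R / (1 - z) - (1 + z) / (1 - z) ^+ 2 * (1 - z ^+ n).
Proof.
move=> z1; have w0 : 1 - z != 0 by rewrite subr_eq0 eq_sym.
elim: n => [|n IH]; first by rewrite /pair_sum big_ord0 expr0; field.
by rewrite pair_sumS IH -muln2 (exprS z n); field.
Qed.

(* The value at 0 of the linear particular solution of [triple_sumS]; the
   homogeneous solutions are multiples of z^(3n). *)
Definition triple_const (R : realType) (z : R) : R :=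
  - (3 * (1 + z) / ((1 - z) * (1 - z ^+ 3)) * z ^+ 3 + 6 * z / (1 - z)
     + 3 * z * (1 + z) / (1 - z) ^+ 2 + 2) / (1 - z ^+ 3).

(** A linear particular solution, the response to the z^n term of [pair_sumE], and a multiple of
    z^(3n) chosen to give 0 at n = 0. *)
Lemma triple_sumE (R : realType) (z : R) n : z != 1 -> z ^+ 3 != 1 ->
  triple_sum z n =
  3 * (1 + z) / ((1 - z) * (1 - z ^+ 3)) * n%:R
  + triple_const z + 3 / (1 - z) ^+ 3 * z ^+ n
  - (triple_const z + 3 / (1 - z) ^+ 3) * (z ^+ n) ^+ 3.
Proof.
move=> z1 z3; have w0 : 1 - z != 0 by rewrite subr_eq0 eq_sym.
have w3 : 1 - z ^+ 3 != 0 by rewrite subr_eq0 eq_sym.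
elim: n => [|n IH]; first by rewrite /triple_sum big_ord0 expr0; ring.
rewrite triple_sumS IH pair_sumE // /triple_const.
by rewrite (exprS z n); field; rewrite w0 w3.
Qed.

(** * Bounding the expected proportion by rank sums *)

Lemma expected_safe_proportion_bounds (R : realType) n
    (z := expR (- n%:R^-1) : R) : (4 <= n)%N ->
  expR (6 - 6 * n%:R * lower_rate R n) * expR (- 3)
    * (triple_sum z n / n%:R ^+ 3)
  <= expected_safe_proportion R n
  <= z ^- 5 * expR (- 3) * (triple_sum z n / n%:R ^+ 3).
Proof.
move=> n4.
pose m i j k := (minn i j + minn i k + minn j k).*2%N.
pose h i j k : R := 'C(n ^ 3 - (3 * n + m i j k - 2), n ^ 2)%:R
  / 'C(n ^ 3, n ^ 2)%:R.
have -> : expected_safe_proportion R n =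
    (\sum_(i < n) \sum_(j < n) \sum_(k < n) h i./2 j./2 k./2) / n%:R ^+ 3.
  rewrite expected_safe_proportionE -natrX; congr (_ / _).
  transitivity (\sum_(x : Defs.space n)
      h (edge n (x i0)) (edge n (x i1)) (edge n (x i2))).
    by apply: eq_bigr => x _; rewrite /h /m -card_attackers addnK.
  apply: etrans.
    apply: (big_space +%R (fun p q r => h (edge n p) (edge n q) (edge n r))).
  rewrite /= -[RHS](big_edge _ n
    (fun i => \sum_(j < n) \sum_(k < n) h i j./2 k./2)).
  apply: eq_bigr => p _.
  rewrite -[RHS](big_edge _ n (fun j => \sum_(k < n) h _ j k./2)).
  apply: eq_bigr => q _.
  by rewrite -[RHS](big_edge _ n (h _ _)).
have bnd (i j k : 'I_n) :
    expR (6 - 6 * n%:R * lower_rate R n) * expR (- 3) * z ^+ min_sum i j k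
    <= h i./2 j./2 k./2 <= z ^- 5 * expR (- 3) * z ^+ min_sum i j k.
  (* Halving and redoubling ranks loses at most 1 in each of the three minima; with the 2 subtracted
     in [h] this gives the slack 5. *)
  have := ltn_ord i; have := ltn_ord j; have := ltn_ord k.
  have halfm (a b : nat) :
      (minn a b <= (minn a./2 b./2).*2 + 1 <= (minn a b).+1)%N by lia.
  move: (halfm i j) (halfm i k) (halfm j k).
  move=> ????? ?; apply: safe_probability_bounds; rewrite // /m /min_sum; lia.
set L := expR (6 - _) in bnd *.
rewrite ![_ * (_ / _)]mulrA.
have N0 : 0 < (n%:R ^+ 3)^-1 :> R by rewrite invr_gt0 exprn_gt0 // ltr0n; lia.
by rewrite !(ler_pM2r N0); rewrite /triple_sum !mulr_sumr; apply/andP; split;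
  apply: ler_sum => i _; rewrite mulr_sumr; apply: ler_sum => j _;
  rewrite mulr_sumr; apply: ler_sum => k _; case/andP: (bnd i j k).
Qed.

(** * Limits as the side length grows *)

Local Open Scope classical_set_scope.

Lemma cvg_invn (R : realType) : (n%:R^-1 : R) @[n --> \oo] --> (0 : R).
Proof. by rewrite -cvg_shiftS; exact: cvg_harmonic. Qed.

Lemma cvg_expR_invn (R : realType) (c : R) :
  expR (c * n%:R^-1) @[n --> \oo] --> (1 : R).
Proof.
suff: expR (c * n%:R^-1) @[n --> \oo] --> expR (c * 0 : R).
  by rewrite mulr0 expR0.
apply: cvg_comp; last exact: continuous_expR.
by apply: cvgM; [exact: cvg_cst|exact: cvg_invn].
Qed.

(** With z = exp(- 1 / n), the inequality 1 + t <= exp t at t = - 1 / n gives n (1 - z) <= 1, and at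
    t = 1 / n it gives z <= n (1 - z). *)
Lemma cvg_expR_slope (R : realType) :
  (n%:R * (1 - expR (- n%:R^-1)) : R) @[n --> \oo] --> (1 : R).
Proof.
apply: (@squeeze_cvgr _ _ _ _ (fun n => expR (- 1 * n%:R^-1)) (fun=> 1));
  last 2 first.
- exact: cvg_expR_invn.
- exact: cvg_cst.
near=> n.
have n0 : 0 < n%:R :> R by rewrite ltr0n; near: n; exact: nbhs_infty_gt.
have e1 := expR_ge1Dx (- n%:R^-1 : R); have e2 := expR_ge1Dx (n%:R^-1 : R).
have z0 := expR_gt0 (- n%:R^-1 : R).
rewrite expRN in e1 z0 *; rewrite mulN1r expRN.
have nV : n%:R * n%:R^-1 = 1 :> R by rewrite mulfV ?gt_eqF.
set t := n%:R^-1 in e1 e2 nV z0 *; set E := expR t in e1 e2 z0 *.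
have E0 : 0 < E by exact: expR_gt0.
have EV : E * E^-1 = 1 by rewrite mulfV ?gt_eqF.
set w := E^-1 in e1 z0 EV *.
apply/andP; split; last by nra.
have : w * (1 + t) <= 1 by rewrite -[leRHS]EV mulrC ler_pM2r.
nra.
Unshelve. all: by end_near. Qed.

Lemma cvg_triple_sum (R : realType) :
  (triple_sum (expR (- n%:R^-1)) n / n%:R ^+ 3 : R) @[n --> \oo]
  --> (3 * expR (- 1) - 2 / 3 - expR (- 1) ^+ 3 / 3 : R).
Proof.
(* The factor n^-3 is spread over [triple_sumE] so that every ingredient converges: [u] tends to 1,
   [v] is n (1 - z^3) and tends to 3, [K] is [triple_const] over n^3, and [G] is the whole quotient,
   with z^n = q. *)
pose z n : R := expR (- n%:R^-1); pose u n := n%:R * (1 - z n).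
pose v n := u n * (1 + z n + z n ^+ 2); pose q : R := expR (- 1).
pose K n := - (3 * (1 + z n) / (u n * v n) * z n ^+ 3
    + 6 * z n / u n * n%:R^-1 + 3 * z n * (1 + z n) / u n ^+ 2
    + 2 * n%:R^-1 ^+ 2) / v n.
pose G n := 3 * (1 + z n) / (u n * v n) + K n + 3 / u n ^+ 3 * q
  - (K n + 3 / u n ^+ 3) * q ^+ 3.
have cy := @cvg_invn R.
have cz : z n @[n --> \oo] --> (1 : R).
  by under eq_fun do rewrite /z -mulN1r; exact: cvg_expR_invn.
have cu : u n @[n --> \oo] --> (1 : R) by exact: cvg_expR_slope.
have cz1 : (1 + z n) @[n --> \oo] --> (2 : R).
  by apply: cvgD => //; exact: cvg_cst.
have cX (k : nat) (f : nat -> R) (l : R) :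
    f n @[n --> \oo] --> l -> f n ^+ k @[n --> \oo] --> l ^+ k.
  move=> fl; apply: (cvg_comp f (fun x => x ^+ k)); first exact: fl.
  exact: exprn_continuous.
have cv : v n @[n --> \oo] --> (3 : R).
  have -> : (3 : R) = 1 * (2 + 1 ^+ 2) by ring.
  by apply: cvgM => //; apply: cvgD => //; exact: cX.
have nz (k : nat) : k.+1%:R != 0 :> R by rewrite pnatr_eq0.
(* This is - 8 / 3, left in the shape that the limit rules produce from [K]. *)
pose l : R := - (3 * 2 / (1 * 3) * 1 ^+ 3 + 6 * 1 / 1 * 0 + 3 * 1 * 2 / 1 ^+ 2
            + 2 * 0 ^+ 2) / 3.
have cK : K n @[n --> \oo] --> l.
  apply: cvgM; last by apply: cvgV.
  apply: cvgN; apply: cvgD; last by apply: cvgM; [exact: cvg_cst|exact: cX].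
  apply: cvgD; last first.
    apply: cvgM; first by apply: cvgM => //; apply: cvgM => //; exact: cvg_cst.
    by apply: cvgV; [rewrite expr1n oner_neq0|exact: cX].
  apply: cvgD; apply: cvgM => //; [|exact: cX|].
    apply: cvgM; first by apply: cvgM => //; exact: cvg_cst.
    by apply: cvgV; [rewrite mul1r|apply: cvgM].
  apply: cvgM; first by apply: cvgM => //; exact: cvg_cst.
  by apply: cvgV => //; exact: oner_neq0.
have c3 : (3 / u n ^+ 3) @[n --> \oo] --> (3 / 1 ^+ 3 : R).
  apply: cvgM; first exact: cvg_cst.
  by apply: cvgV; [rewrite expr1n oner_neq0|exact: cX].
have cG : G n @[n --> \oo] --> (3 * q - 2 / 3 - q ^+ 3 / 3).
  have -> : 3 * q - 2 / 3 - q ^+ 3 / 3 =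
      3 * 2 / (1 * 3) + l + 3 / 1 ^+ 3 * q - (l + 3 / 1 ^+ 3) * q ^+ 3.
    by rewrite /l; field.
  apply: cvgB; last by apply: cvgM; [exact: cvgD|exact: cvg_cst].
  apply: cvgD; last by apply: cvgM; [exact: c3|exact: cvg_cst].
  apply: cvgD => //; apply: cvgM; first by apply: cvgM => //; exact: cvg_cst.
  by apply: cvgV; [rewrite mul1r|apply: cvgM].
apply: cvg_trans cG; apply: near_eq_cvg; near=> n.
have n0 : 0 < n%:R :> R by rewrite ltr0n; near: n; exact: nbhs_infty_gt.
have z0 : 0 < z n by exact: expR_gt0.
have z1 : z n < 1 by rewrite /z expR_lt1 oppr_lt0 invr_gt0.
have z3 : z n ^+ 3 < 1 by rewrite exprn_ilt1 // ltW.
rewrite triple_sumE ?lt_eqF // /G -/(z n).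
have -> : z n ^+ n = q by rewrite /z /q -expRM_natl mulrN mulfV // gt_eqF.
rewrite /K /v /u /triple_const.
have h1 : 1 - z n != 0 by rewrite gt_eqF // subr_gt0.
have h3 : 1 - z n ^+ 3 != 0 by rewrite gt_eqF // subr_gt0.
have h4 : 1 + z n + z n ^+ 2 != 0 by rewrite gt_eqF //; nra.
have h0 : n%:R != 0 :> R by rewrite gt_eqF.
have -> : 1 - z n ^+ 3 = (1 - z n) * (1 + z n + z n ^+ 2) by ring.
by field; rewrite h1 h4 h0.
Unshelve. all: by end_near. Qed.

Lemma cvg_lower_factor (R : realType) :
  expR (6 - 6 * n%:R * lower_rate R n) @[n --> \oo] --> (1 : R).
Proof.
suff: expR (6 - 6 * n%:R * lower_rate R n) @[n --> \oo]
    --> expR (6 - 6 * (1 - 0 - 6 * 0 ^+ 2)^-1 : R).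
  by rewrite expr0n mulr0 !subr0 invr1 mulr1 subrr expR0.
apply: cvg_comp; last exact: continuous_expR.
have cy := @cvg_invn R.
(* Dividing numerator and denominator by n^2 turns n times [lower_rate] into 1 / (1 - 1 / n - 6 /
   n^2). *)
have c6 : (fun n => 6 - 6 * (1 - n%:R^-1 - 6 * n%:R^-1 ^+ 2)^-1) @ \oo
    --> (6 - 6 * (1 - 0 - 6 * 0 ^+ 2)^-1 : R).
  apply: cvgB; first exact: cvg_cst.
  apply: cvgM; first exact: cvg_cst.
  apply: cvgV; first by rewrite expr0n mulr0 !subr0 oner_neq0.
  apply: cvgB; first by apply: cvgB => //; exact: cvg_cst.
  apply: cvgM; first exact: cvg_cst.
  by apply: (cvg_comp _ (fun x => x ^+ 2)); [exact: cy|exact: exprn_continuous].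
apply: cvg_trans c6; apply: near_eq_cvg; near=> n.
have n4 : 4 <= n%:R :> R by
  rewrite (ler_nat R 4); near: n; exact: nbhs_infty_ge.
rewrite /lower_rate; field.
by apply/andP; split; apply: lt0r_neq0; nra.
Unshelve. all: by end_near. Qed.

Theorem mainTheorem6 (R : realType) :
  (fun n : nat => expected_safe_proportion R n) @ \oo -->
  ((-1 + 9 * expR 1 ^+ 2 - 2 * expR 1 ^+ 3) / (3 * expR 1 ^+ 6) : R).
Proof.
(* The target is split into the limits of the three factors shared by both bounds: the correction,
   e^-3 and the scaled rank sum. *)
have -> : (-1 + 9 * expR 1 ^+ 2 - 2 * expR 1 ^+ 3) / (3 * expR 1 ^+ 6) =
    1 * expR (- 3) * (3 * expR (- 1) - 2 / 3 - expR (- 1) ^+ 3 / 3) :> R.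
  have -> : expR (- 3) = expR 1 ^- 3 :> R by rewrite expRN -expRM_natl mulr1.
  by rewrite expRN; field; rewrite gt_eqF ?expR_gt0.
have cT := @cvg_triple_sum R.
apply: (@squeeze_cvgr _ _ _ _
  (fun n => expR (6 - 6 * n%:R * lower_rate R n) * expR (- 3)
    * (triple_sum (expR (- n%:R^-1)) n / n%:R ^+ 3))
  (fun n => expR (- n%:R^-1) ^- 5 * expR (- 3)
    * (triple_sum (expR (- n%:R^-1)) n / n%:R ^+ 3))).
- near=> n; apply: expected_safe_proportion_bounds.
  by near: n; exact: nbhs_infty_ge.
- apply: cvgM => //; apply: cvgM; [exact: cvg_lower_factor|exact: cvg_cst].
- apply: cvgM => //; apply: cvgM; last exact: cvg_cst.
  (* The correction z^-5 equals exp(5 / n). *)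
  under eq_fun do rewrite -expRM_natl -expRN mulrN opprK.
  exact: cvg_expR_invn.
Unshelve. all: by end_near. Qed.
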